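(* For $n\ge 1$ and every integer partition $\lambda$ of $n$, $$d_n\bigl(\lambda,(n)\bigr)=\ell(\lambda)-1,\qquad d_n\bigl(\lambda,(1^n)\bigr)=n-\ell(\lambda).$$ Consequently, $\operatorname{diam}(\Gamma_n)=n-1$. For $n=0$, the graph $\Gamma_0$ consists of one vertex and has diameter zero.
   Context: For $n\ge 0$, the rank-profile refinement graph $\Gamma_n$ is the finite graph whose vertices are the integer partitions of $n$ (with the empty partition as the sole vertex when $n=0$). Two partitions are adjacent when one is obtained from the other by replacing one part $r$ by two positive parts $a,b$ with $a+b=r$. $d_n$ denotes the graph distance in $\Gamma_n$, $\operatorname{diam}(\Gamma_n)$ its diameter (the maximum of $d_n$ over pairs of vertices), and $\ell(\lambda)$ the number of parts of $\lambda$. $(n)$ is the partition with the single part $n$, and $(1^n)$ is the partition with $n$ parts all equal to $1$. *)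

(* Defs.v *)
From HB Require Import structures.
From mathcomp Require Import all_boot.

Set Implicit Arguments.
Unset Strict Implicit.
Unset Printing Implicit Defensive.

(* An integer partition is the non-increasing sequence of its parts. *)
Definition is_intpart (n : nat) (s : seq nat) : bool :=
  [&& sorted geq s, all (leq 1) s & sumn s == n].

Record intpart (n : nat) : Type :=
  IntPart { parts :> seq nat; partsP : is_intpart n parts }.

HB.instance Definition _ n := [isSub for @parts n].
HB.instance Definition _ n := [Countable of intpart n by <:].

(* The finType structure comes from an embedding into the sequences of length
   at most n over {0, ..., n}. *)
Section Finite.
Variable n : nat.

Lemma size_intpart (lam : intpart n) : size lam <= n.
Proof.
case: lam => s /= /and3P[_ s_gt0 /eqP <-].
elim: s s_gt0 => //= x s IHs /andP[x_gt0 /IHs s_le]; rewrite -add1n leq_add //.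
Qed.

Lemma leq_intpart (lam : intpart n) r : r \in parts lam -> r <= n.
Proof.
case: lam => s /= /and3P[_ _ /eqP <-].
by move=> r_s; rewrite (perm_sumn (perm_to_rem r_s)) leq_addr.
Qed.

Definition intpart_bseq (lam : intpart n) : {bseq n of 'I_n.+1} :=
  insub_bseq n [seq inord r | r <- parts lam].

Definition bseq_intpart (b : {bseq n of 'I_n.+1}) : option (intpart n) :=
  insub [seq val i | i <- b].

Lemma intpart_bseqK : pcancel intpart_bseq bseq_intpart.
Proof.
move=> lam; rewrite /bseq_intpart /intpart_bseq /insub_bseq.
rewrite val_insubd size_map size_intpart -map_comp.
rewrite (_ : map _ _ = parts lam) ?valK //.
by rewrite -[RHS]map_id; apply/eq_in_map => r /leq_intpart r_n /=; rewrite inordK.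
Qed.

HB.instance Definition _ : isFinite (intpart n) := PCanIsFinite intpart_bseqK.

End Finite.

Lemma onepart_subproof n : 0 < n -> is_intpart n [:: n].
Proof. by move=> n_gt0; rewrite /is_intpart /= n_gt0 addn0 eqxx. Qed.

Definition onepart n (n_gt0 : 0 < n) : intpart n :=
  IntPart (onepart_subproof n_gt0).

Lemma allones_subproof n : is_intpart n (nseq n 1).
Proof.
rewrite /is_intpart sumn_nseq mul1n eqxx all_nseq orbT !andbT.
by case: n => //; elim.
Qed.

Definition allones n : intpart n := IntPart (allones_subproof n).

(* mu arises from lam by replacing one part a + b by the two parts a and b;
   perm_eq compares multisets of parts. *)
Definition splits n (lam mu : intpart n) : bool :=
  [exists a : 'I_n.+1, exists b : 'I_n.+1,
     [&& 0 < a, 0 < b, a + b \in parts lam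
       & perm_eq mu [:: nat_of_ord a, nat_of_ord b & rem (a + b) lam]]].

(* The bounds a, b <= n in splits are no restriction. *)
Lemma splitsP n (lam mu : intpart n) :
  reflect (exists a b : nat, [/\ 0 < a, 0 < b, a + b \in parts lam
                               & perm_eq mu [:: a, b & rem (a + b) lam]])
          (splits lam mu).
Proof.
apply: (iffP existsP) => [[a /existsP[b /and4P[]]]|[a [b [a0 b0 ab_lam mu_eq]]]].
  by exists a, b; split.
have ab_n := leq_intpart ab_lam.
have a_n : a < n.+1 by apply: leq_trans ab_n; apply: leq_addr.
have b_n : b < n.+1 by apply: leq_trans ab_n; apply: leq_addl.
exists (Ordinal a_n); apply/existsP; exists (Ordinal b_n); exact/and4P.
Qed.

Definition refinement n : rel (intpart n) :=
  fun lam mu => splits lam mu || splits mu lam.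

Section Distance.
Variables (T : finType) (e : rel T).

Definition walk (x y : T) (k : nat) : bool :=
  [exists p : k.-tuple T, path e x p && (last x p == y)].

(* The least length of an e-walk from x to y. A shortest walk has length less
   than #|T|, so gdist x y = #|T| exactly when y is unreachable from x: the
   value #|T| plays the role of an infinite distance. *)
Definition gdist (x y : T) : nat := find (walk x y) (iota 0 #|T|).

Lemma gdistP x y k : walk x y k ->
  [/\ gdist x y < #|T|, walk x y (gdist x y) & gdist x y <= k].
Proof.
case/existsP=> p /andP[e_p /eqP p_y].
have [k' k'_k [k'_T wk']] : exists2 k', k' <= k & k' < #|T| /\ walk x y k'.
  case/shortenP: e_p p_y => q e_q uq q_p q_y; exists (size q).
    by rewrite -(size_tuple p); apply: uniq_leq_size => //; case/andP: uq.
  split; first by rewrite -[_.+1]/(size (x :: q)) -(card_uniqP uq) max_card.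
  by apply/existsP; exists (in_tuple q); rewrite e_q q_y eqxx.
have has_w : has (walk x y) (iota 0 #|T|).
  by apply/hasP; exists k'; rewrite // mem_iota.
have d_T : gdist x y < #|T| by move: has_w; rewrite has_find size_iota.
split=> //; first by have := nth_find 0 has_w; rewrite nth_iota.
apply: leq_trans k'_k; rewrite leqNgt; apply/negP => k'_d.
by have := before_find 0 k'_d; rewrite nth_iota // wk'.
Qed.

Definition diam : nat := \max_(x : T) \max_(y : T) gdist x y.

End Distance.

(* Main.v *)
Require Import Defs.
From HB Require Import structures.
From mathcomp Require Import all_boot.

Set Implicit Arguments.
Unset Strict Implicit.
Unset Printing Implicit Defensive.

(** An edge changes the number of parts by exactly one, so the distance between
    two partitions is at least the difference of their lengths.  Merging two
    parts, resp. splitting a part larger than one, is possible until (n), resp.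
    (1^n), is reached, so this bound is attained there.  The routes from lam to
    mu through (n) and through (1^n) have total length 2(n - 1), hence one of
    them has length at most n - 1. *)

Section Walks.
Variables (T : finType) (e : rel T).

Lemma walk0 (x : T) : walk e x x 0.
Proof. by apply/existsP; exists [tuple]; rewrite /= eqxx. Qed.

Lemma walkS (x y z : T) k : e x y -> walk e y z k -> walk e x z k.+1.
Proof.
move=> exy /existsP[p /andP[ep pz]]; apply/existsP; exists [tuple of y :: p].
by rewrite /= exy ep.
Qed.

Lemma walk_cat (x y z : T) j k :
  walk e x y j -> walk e y z k -> walk e x z (j + k).
Proof.
move=> /existsP[p /andP[ep /eqP py]] /existsP[q /andP[eq qz]].
apply/existsP; exists [tuple of p ++ q].
by rewrite /= cat_path last_cat ep py eq.
Qed.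

Lemma walk_sym (x y : T) k : symmetric e -> walk e x y k -> walk e y x k.
Proof.
move=> e_sym /existsP[p]; case: p => p /= /eqP <- {k}.
elim: p x => [|z p IHp] x /=; first by move/eqP->; apply: walk0.
case/andP=> /andP[exz ep] py; rewrite -addn1.
apply: walk_cat (IHp z _) _; first by rewrite ep.
by apply: walkS (walk0 x); rewrite e_sym.
Qed.

(** Source of all lower bounds on distances: a function that drops by at most one along each edge
    drops by at most [k] along [k] edges. *)
Lemma walk_lipschitz (f : T -> nat) x y k :
  (forall u v, e u v -> f u <= (f v).+1) -> walk e x y k -> f x <= f y + k.
Proof.
move=> f_e /existsP[p]; case: p => p /= /eqP <- {k}.
elim: p x => [|z p IHp] x /=; first by move/eqP->; rewrite addn0.
case/andP=> /andP[exz ep] py; apply: leq_trans (f_e _ _ exz) _.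
by rewrite addnS ltnS IHp ?ep.
Qed.

Lemma gdist_eq (x y : T) k :
    walk e x y k -> (forall j, walk e x y j -> k <= j) -> gdist e x y = k.
Proof.
move=> /gdistP[_ w_d d_k] k_min; apply/eqP.
by rewrite eqn_leq d_k k_min.
Qed.

End Walks.

(** The equality case matters: it characterises $(1^n)$ by its length and supplies a part above 1 in
    any shorter partition. *)
Lemma size_leqif_sumn (s : seq nat) :
  all (leq 1) s -> size s <= sumn s ?= iff all (pred1 1) s.
Proof.
elim: s => [|x s IHs] //= /andP[x_gt0 /IHs s_le].
by rewrite -add1n; apply: leqif_add => //; split; rewrite // eq_sym.
Qed.

Section Refinement.
Variable n : nat.
Implicit Types lam mu : intpart n.

(** Sorting [s] gives the witness, so merges and splits can be built as multisets, without care for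
    order. *)
Lemma exists_intpart s :
  all (leq 1) s -> sumn s = n -> exists lam, perm_eq lam s.
Proof.
move=> s_gt0 s_n.
have sP : is_intpart n (sort geq s).
  apply/and3P; split; first by apply: sort_sorted => i j; apply: leq_total.
    by rewrite all_sort.
  by rewrite (perm_sumn (permEl (perm_sort _ _))) s_n.
by exists (IntPart sP); rewrite /= perm_sort.
Qed.

Lemma parts_gt0 lam : all (leq 1) lam.
Proof. by case: lam => s /= /and3P[]. Qed.

Lemma sumn_parts lam : sumn lam = n.
Proof. by case: lam => s /= /and3P[_ _ /eqP]. Qed.

Lemma size_gt0_intpart lam : 0 < n -> 0 < size lam.
Proof. by case: (parts lam) (sumn_parts lam) => // <-. Qed.

Lemma size_splits lam mu : splits lam mu -> size mu = (size lam).+1.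
Proof.
case/splitsP=> a [b [_ _ ab_lam /perm_size ->]] /=.
by rewrite (perm_size (perm_to_rem ab_lam)).
Qed.

Lemma refinement_sym : symmetric (@refinement n).
Proof. by move=> lam mu; rewrite /refinement orbC. Qed.

Lemma size_refinement lam mu :
  refinement lam mu -> size lam <= (size mu).+1.
Proof. by case/orP=> /size_splits -> //; apply: leqW. Qed.

(** The length changes by one along each edge; the second inequality is the first one for the
    reversed walk. *)
Lemma walk_size lam mu k : walk (@refinement n) lam mu k ->
  size lam <= size mu + k /\ size mu <= size lam + k.
Proof.
move=> w; split; first exact: walk_lipschitz size_refinement w.
exact: walk_lipschitz size_refinement (walk_sym refinement_sym w).
Qed.

Lemma exists_merge lam : 1 < size lam -> exists mu, splits mu lam.
Proof.
have := parts_gt0 lam; have := sumn_parts lam.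
case def_lam: (parts lam) => [|a [|b s]] //= lam_n /and3P[a0 b0 s0] _.
have [||mu mu_s] := @exists_intpart ((a + b) :: s).
- by rewrite /= s0 addn_gt0 a0.
- by rewrite /= -addnA.
have ab_mu : a + b \in parts mu by rewrite (perm_mem mu_s) mem_head.
exists mu; apply/splitsP; exists a, b; split=> //.
(* After [a] and [b] are cancelled, putting [a + b] in front of both sides turns the goal into
   [mu_s]. *)
rewrite def_lam !perm_cons perm_sym -(perm_cons (a + b)).
by rewrite -(permPl (perm_to_rem ab_mu)).
Qed.

(** Having fewer than $n$ parts is the strict case of [size_leqif_sumn], so some part [r] exceeds 1;
    a 1 is split off from it. *)
Lemma exists_split lam : size lam < n -> exists mu, splits lam mu.
Proof.
rewrite -[X in _ < X](sumn_parts lam) (ltn_leqif (size_leqif_sumn (parts_gt0 lam))).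
case/allPn=> r r_lam /= r_neq1.
have r_gt1 : 1 < r by rewrite ltn_neqAle eq_sym r_neq1 (allP (parts_gt0 lam)).
have r_eq : 1 + r.-1 = r by rewrite add1n prednK // ltnW.
have lam_r := perm_to_rem r_lam.
have := parts_gt0 lam; rewrite (perm_all _ lam_r) => /andP[_ rem0].
have := sumn_parts lam; rewrite (perm_sumn lam_r) /= => rem_n.
have [||mu mu_s] := @exists_intpart [:: 1, r.-1 & rem r lam].
- by apply/and3P; split; rewrite // -ltnS prednK // ltnW.
- by rewrite /= addnA r_eq.
exists mu; apply/splitsP; exists 1, r.-1; rewrite r_eq; split=> //.
by rewrite -ltnS prednK // ltnW.
Qed.

Lemma size1_onepart (n_gt0 : 0 < n) lam : size lam = 1 -> lam = onepart n_gt0.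
Proof.
move=> lam1; apply: val_inj => /=; have := sumn_parts lam.
by case: (parts lam) lam1 => [|r []] //= _; rewrite addn0 => ->.
Qed.

Lemma sizen_allones lam : size lam = n -> lam = allones n.
Proof.
move=> lam_n; apply: val_inj => /=; rewrite -[in RHS]lam_n; apply/all_pred1P.
by rewrite -(size_leqif_sumn (parts_gt0 lam)) sumn_parts lam_n.
Qed.

Lemma walk_onepart (n_gt0 : 0 < n) lam :
  walk (@refinement n) lam (onepart n_gt0) (size lam - 1).
Proof.
have := size_gt0_intpart lam n_gt0.
case def_k: (size lam) => [|k] // _; rewrite subn1 /=.
elim: k => [|k IHk] in lam def_k *.
  by rewrite (size1_onepart n_gt0 def_k) walk0.
have [|mu mu_lam] := @exists_merge lam; first by rewrite def_k.
apply: (@walkS _ _ _ mu); first by rewrite /refinement mu_lam orbT.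
by apply: IHk; have := size_splits mu_lam; rewrite def_k => -[].
Qed.

Lemma walk_allones lam :
  walk (@refinement n) lam (allones n) (n - size lam).
Proof.
(* Induction on the number [k] of splits still to be made, with [size lam + k = n] as invariant. *)
have := subnKC (size_intpart lam); move: (n - _) => k.
elim: k lam => [|k IHk] lam.
  by rewrite addn0 => /sizen_allones ->; apply: walk0.
move=> def_n; have [|mu lam_mu] := @exists_split lam.
  by rewrite -[X in _ < X]def_n addnS ltnS leq_addr.
apply: (@walkS _ _ _ mu); first by rewrite /refinement lam_mu.
by apply: IHk; rewrite (size_splits lam_mu) addSnnS.
Qed.

Lemma gdist_onepart (n_gt0 : 0 < n) lam :
  gdist (@refinement n) lam (onepart n_gt0) = size lam - 1.
Proof.
apply: gdist_eq; first exact: walk_onepart.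
by move=> j /walk_size[lam_j _]; rewrite leq_subLR.
Qed.

Lemma gdist_allones lam :
  gdist (@refinement n) lam (allones n) = n - size lam.
Proof.
apply: gdist_eq; first exact: walk_allones.
by move=> j /walk_size[_]; rewrite /= size_nseq leq_subLR.
Qed.

Lemma gdist_refinement_le lam mu :
  0 < n -> gdist (@refinement n) lam mu <= n - 1.
Proof.
move=> n_gt0.
have via nu j k : walk (@refinement n) lam nu j -> walk (@refinement n) mu nu k ->
    gdist (@refinement n) lam mu <= j + k.
  move=> w_j /(walk_sym refinement_sym) w_k.
  by case: (gdistP (walk_cat w_j w_k)).
have d1 := via _ _ _ (walk_onepart n_gt0 lam) (walk_onepart n_gt0 mu).
have dn := via _ _ _ (walk_allones lam) (walk_allones mu).
(* The truncated subtractions are exact here because $1 \le \ell(\nu) \le n$. *)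
have sum_n1 (nu : intpart n) : size nu - 1 + (n - size nu) = n - 1.
  by rewrite addnC addnBA ?size_gt0_intpart // subnK ?size_intpart.
(* Twice the distance is at most the total length of both routes, regrouped by endpoint. *)
by rewrite -leq_double -!addnn (leq_trans (leq_add d1 dn)) // addnACA !sum_n1.
Qed.

Lemma diam_refinement : 0 < n -> diam (@refinement n) = n - 1.
Proof.
move=> n_gt0; apply/eqP; rewrite eqn_leq; apply/andP; split.
  apply/bigmax_leqP => lam _; apply/bigmax_leqP => mu _.
  exact: gdist_refinement_le.
(* The pair $(n)$, $(1^n)$ attains the bound, since $(n)$ has length 1. *)
rewrite -[X in X <= _](gdist_allones (onepart n_gt0)).
by apply: leq_trans (leq_bigmax (onepart n_gt0)); apply: leq_bigmax.
Qed.

End Refinement.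

Lemma intpart0_eq (lam : intpart 0) : lam = allones 0.
Proof.
apply: sizen_allones; apply/eqP; rewrite -leqn0; exact: size_intpart.
Qed.

Theorem proposition5p5 :
  (forall (n : nat) (n_gt0 : 0 < n),
     (forall lam : intpart n,
        gdist (@refinement n) lam (onepart n_gt0) = size lam - 1 /\
        gdist (@refinement n) lam (allones n) = n - size lam) /\
     diam (@refinement n) = n - 1) /\
  (#|{: intpart 0}| = 1 /\ diam (@refinement 0) = 0).
Proof.
split=> [n n_gt0|].
  split; last exact: diam_refinement.
  by move=> lam; rewrite gdist_onepart gdist_allones.
split; first by apply: (@eq_card1 _ (allones 0)) => lam;
  rewrite !inE [lam]intpart0_eq eqxx.
apply/eqP; rewrite -leqn0; apply/bigmax_leqP => lam _; apply/bigmax_leqP => mu _.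
(* The distance becomes [0 - size lam], which truncates to 0. *)
by rewrite [mu]intpart0_eq gdist_allones.
Qed.
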